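(* Let $(S,\mathfrak n)$ be a commutative noetherian local ring and let $\omega\in\mathfrak n$ be a non-zerodivisor. Then there is a fully faithful functor $\mathsf{MF}(\omega,\mathcal P)\longrightarrow\mathsf{Mon}(\omega,\mathcal G)$.
   Context: All modules are finitely generated. $\mathcal P(S)$ is the category of finitely generated projective $S$-modules. A finitely generated $S$-module $M$ is Gorenstein projective if $\mathrm{Ext}^i_S(M,S)=0=\mathrm{Ext}^i_S(\mathrm{Hom}_S(M,S),S)$ for all $i\ge 1$ and the biduality map $M\to \mathrm{Hom}_S(\mathrm{Hom}_S(M,S),S)$ is an isomorphism; $\mathcal G(S)$ is the category of finitely generated Gorenstein projective $S$-modules. $\mathsf{MF}(\omega,\mathcal P)$ is the category of matrix factorizations of $\omega$: objects are ordered pairs of $S$-homomorphisms $(P_1\xrightarrow{\rho_1}P_0,\ P_0\xrightarrow{\rho_0}P_1)$ with $P_1,P_0\in\mathcal P(S)$, $\rho_1\rho_0=\omega\cdot\mathrm{id}_{P_0}$ and $\rho_0\rho_1=\omega\cdot\mathrm{id}_{P_1}$; morphisms $(\rho_1,\rho_0)\to(q_1,q_0)$, where $q_1:Q_1\to Q_0$ and $q_0:Q_0\to Q_1$, are pairs of $S$-homomorphisms $\psi_i:P_i\to Q_i$ with $q_1\psi_1=\psi_0\rho_1$ and $q_0\psi_0=\psi_1\rho_0$. $\mathsf{Mon}(\omega,\mathcal G)$ is the category whose objects are the injective $S$-homomorphisms $(G_1\xrightarrow{f}G_0)$ with $G_1,G_0\in\mathcal G(S)$ and $\omega\,\mathrm{Coker}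 f=0$; morphisms $(G_1\xrightarrow{f}G_0)\to(G'_1\xrightarrow{f'}G'_0)$ are pairs $(\varphi_1,\varphi_0)$ of $S$-homomorphisms $\varphi_i:G_i\to G_i'$ with $f'\varphi_1=\varphi_0 f$. *)

(* Defs.v *)
From HB Require Import structures.
From mathcomp Require Import all_boot all_algebra boolp.
From mathcomp.multinomials Require Import freeg.

Set Implicit Arguments.
Unset Strict Implicit.
Unset Printing Implicit Defensive.

Import GRing.Theory.
Local Open Scope ring_scope.
Local Open Scope quotient_scope.

(* Under the classical axioms of boolp every subset of a type is a boolean
   predicate, so quantifying over {pred R} ranges over all subsets. *)

Definition noetherian (R : comNzRingType) : Prop :=
  forall I : {pred R^o}, submod_closed I ->
    exists (n : nat) (e : 'I_n -> R),
      forall x, x \in I <-> exists c : 'I_n -> R, x = \sum_i c i * e i.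

(* idealr_closed is the library's notion of a proper ideal. *)
Definition maximal_ideal (R : comNzRingType) (m : {pred R}) : Prop :=
  idealr_closed m /\
  forall J : {pred R}, idealr_closed J -> {subset m <= J} -> J =i m.

Definition local_ring (R : comNzRingType) (n : {pred R}) : Prop :=
  maximal_ideal n /\ forall m : {pred R}, maximal_ideal m -> m =i n.

Definition finitely_generated (R : comNzRingType) (M : lmodType R) : Prop :=
  exists (n : nat) (e : 'I_n -> M),
    forall x, exists c : 'I_n -> R, x = \sum_i c i *: e i.

Definition projective (R : comNzRingType) (P : lmodType R) : Prop :=
  forall (A B : lmodType R) (g : {linear A -> B}) (f : {linear P -> B}),
    (forall b, exists a, g a = b) ->
    exists h : {linear P -> A}, forall x, g (h x) = f x.

Section HomModule.
Variables (R : comNzRingType) (M N : lmodType R).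
Implicit Types f g h : {linear M -> N}.

Lemma linear_ext f g : f =1 g -> f = g.
Proof.
case: f => f [[fa] [fs]]; case: g => g [[ga] [gs]] /= /funext efg; subst g.
by rewrite (Prop_irrelevance fa ga) (Prop_irrelevance fs gs).
Qed.

HB.instance Definition _ := gen_eqMixin {linear M -> N}.
HB.instance Definition _ := gen_choiceMixin {linear M -> N}.

Definition hom_zero : {linear M -> N} := \0.
Definition hom_opp f : {linear M -> N} := \- f.
Definition hom_add f g : {linear M -> N} := f \+ g.
Definition hom_scale (a : R) f : {linear M -> N} := a \*: f.

Fact hom_addA : associative hom_add.
Proof. by move=> f g h; apply: linear_ext => x /=; rewrite addrA. Qed.
Fact hom_addC : commutative hom_add.
Proof. by move=> f g; apply: linear_ext => x /=; rewrite addrC. Qed.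
Fact hom_add0 : left_id hom_zero hom_add.
Proof. by move=> f; apply: linear_ext => x /=; rewrite add0r. Qed.
Fact hom_addN : left_inverse hom_zero hom_opp hom_add.
Proof. by move=> f; apply: linear_ext => x /=; rewrite addNr. Qed.
HB.instance Definition _ :=
  GRing.isZmodule.Build {linear M -> N} hom_addA hom_addC hom_add0 hom_addN.

Fact hom_scaleA a b f : hom_scale a (hom_scale b f) = hom_scale (a * b) f.
Proof. by apply: linear_ext => x /=; rewrite scalerA. Qed.
Fact hom_scale1 : left_id 1 hom_scale.
Proof. by move=> f; apply: linear_ext => x /=; rewrite scale1r. Qed.
Fact hom_scaleDr : right_distributive hom_scale +%R.
Proof. by move=> a f g; apply: linear_ext => x /=; rewrite scalerDr. Qed.
Fact hom_scaleDl f : {morph hom_scale^~ f : a b / a + b}.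
Proof. by move=> a b; apply: linear_ext => x /=; rewrite scalerDl. Qed.
HB.instance Definition _ :=
  GRing.Zmodule_isLmodule.Build R {linear M -> N}
    hom_scaleA hom_scale1 hom_scaleDr hom_scaleDl.

End HomModule.

Section Precomposition.
Variables (R : comNzRingType) (A B N : lmodType R) (d : {linear A -> B}).

Definition precomp (f : {linear B -> N}) : {linear A -> N} := f \o d.

Fact precomp_is_linear : linear precomp.
Proof. by move=> a f g; apply: linear_ext. Qed.
HB.instance Definition _ :=
  GRing.isLinear.Build R {linear B -> N} {linear A -> N} _ precomp
    precomp_is_linear.

End Precomposition.

Section Kernel.
Variables (R : comNzRingType) (V W : lmodType R) (f : {linear V -> W}).

Definition in_kernel : {pred V} := fun x => f x == 0.

Fact in_kernel_submod : submod_closed in_kernel.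
Proof.
split=> [|a x y]; rewrite !unfold_in ?raddf0 // => /eqP fx /eqP fy.
by rewrite linearP fx fy scaler0 addr0.
Qed.
HB.instance Definition _ :=
  GRing.isSubmodClosed.Build R V in_kernel in_kernel_submod.

Record kernel := Kernel { kernel_val : V; _ : kernel_val \in in_kernel }.

HB.instance Definition _ := [isSub for kernel_val].
HB.instance Definition _ := [Choice of kernel by <:].
HB.instance Definition _ := [SubChoice_isSubLmodule of kernel by <:].

End Kernel.

Section Cokernel.
Variables (R : comNzRingType) (V W : lmodType R) (f : {linear V -> W}).

Definition in_image : {pred W} := fun y => `[< exists x, f x = y >].

Fact in_image_submod : submod_closed in_image.
Proof.
split=> [|a y1 y2].
  by apply/asboolP; exists 0; rewrite raddf0.
move=> /asboolP[x1 <-] /asboolP[x2 <-].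
by apply/asboolP; exists (a *: x1 + x2); rewrite linearP.
Qed.
HB.instance Definition _ :=
  GRing.isSubmodClosed.Build R W in_image in_image_submod.

Definition coker := Quotient.quot in_image.
HB.instance Definition _ := GRing.Zmodule.on coker.
HB.instance Definition _ := EqQuotient.on coker.

Definition coker_scale (a : R) (c : coker) : coker := \pi_coker (a *: repr c).

Fact pi_coker_scale a y : coker_scale a (\pi_coker y) = \pi_coker (a *: y).
Proof.
apply/eqP; rewrite -Quotient.idealrBE -scalerBr rpredZ //.
by rewrite Quotient.idealrBE reprK.
Qed.

Fact pi_coker_add : {morph \pi_coker : x y / x + y}.
Proof. exact: Quotient.pi_add. Qed.

Fact coker_scaleA a b c :
  coker_scale a (coker_scale b c) = coker_scale (a * b) c.
Proof. by rewrite -[c]reprK !pi_coker_scale reprK scalerA. Qed.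
Fact coker_scale1 : left_id 1 coker_scale.
Proof. by move=> c; rewrite -[c]reprK pi_coker_scale scale1r. Qed.
Fact coker_scaleDr : right_distributive coker_scale +%R.
Proof.
move=> a c d; rewrite -[c]reprK -[d]reprK.
by rewrite -pi_coker_add !pi_coker_scale -pi_coker_add scalerDr.
Qed.
Fact coker_scaleDl c : {morph coker_scale^~ c : a b / a + b}.
Proof.
move=> a b; rewrite -[c]reprK.
by rewrite !pi_coker_scale -pi_coker_add scalerDl.
Qed.
HB.instance Definition _ := GRing.Zmodule_isLmodule.Build R coker
  coker_scaleA coker_scale1 coker_scaleDr coker_scaleDl.

End Cokernel.

(* ker g / im f, as the cokernel of f corestricted to ker g *)
Section Cohomology.
Variables (R : comNzRingType) (A B C : lmodType R).
Variables (f : {linear A -> B}) (g : {linear B -> C}).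
Hypothesis gf0 : forall x, g (f x) = 0.

Fact corestrict_subproof x : f x \in in_kernel g.
Proof. by rewrite unfold_in gf0. Qed.

Definition corestrict x : kernel g := Kernel (corestrict_subproof x).

Fact corestrict_is_linear : linear corestrict.
Proof. by move=> a x y; apply: val_inj; rewrite /= linearP. Qed.
HB.instance Definition _ :=
  GRing.isLinear.Build R A (kernel g) _ corestrict corestrict_is_linear.

Definition cohomology : lmodType R := coker corestrict.

End Cohomology.

Section FreeResolution.
Variable R : comNzRingType.

Section FreeLift.
Variables (K : choiceType) (M : lmodType R) (f : K -> M).

Fact fglift_is_linear : linear (fglift f : {freeg K / R} -> M).
Proof.
have subL : {morph fglift f : D E / D - E} by exact: lift_is_additive.
have L0 : fglift f 0 = 0 by rewrite -(subrr 0) subL subrr.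
have addL : {morph fglift f : D E / D + E}.
  by move=> D E; rewrite -{1}(opprK E) -(sub0r E) !subL L0 sub0r opprK.
move=> a D E; rewrite addL; congr (_ + _).
rewrite -(freeg_sumE D) scaler_sumr.
rewrite !(big_morph (fglift f) addL L0) scaler_sumr; apply: eq_bigr => x _.
have -> : a *: << coeff x D *g x >> = << a * coeff x D *g x >>.
  by apply/eqP/freeg_eqP => y; rewrite coeffZ !coeffU mulrA.
by rewrite !liftU scalerA.
Qed.
HB.instance Definition _ :=
  GRing.isLinear.Build R {freeg K / R} M _ (fglift f) fglift_is_linear.

End FreeLift.

(* {freeg M / R} is the free R-module on the underlying set of M, and
   fglift f is its linear map sending the basis element << x >> to f x. *)
Definition free_cover (M : lmodType R) : {linear {freeg M / R} -> M} :=
  fglift (fun x : M => x).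

(* The free resolution ... -> F_1 -> F_0 -> M of M: F_i is the free module on
   the underlying set of the i-th syzygy K_i, where K_0 = M and K_{i+1} is the
   kernel of F_i -> K_i. *)
Fixpoint syzygy (M : lmodType R) (i : nat) : lmodType R :=
  if i is j.+1 then kernel (free_cover (syzygy M j)) else M.

Definition resolution (M : lmodType R) (i : nat) : lmodType R :=
  {freeg (syzygy M i) / R}.

Definition differential (M : lmodType R) (i : nat) :
    {linear resolution M i.+1 -> resolution M i} :=
  (val : kernel (free_cover (syzygy M i)) -> resolution M i)
    \o free_cover (syzygy M i.+1).

Variables M N : lmodType R.

Definition codifferential (i : nat) :
    {linear {linear resolution M i -> N} -> {linear resolution M i.+1 -> N}} :=
  @precomp R _ _ N (differential M i).

Fact codifferentialK i f : codifferential i.+1 (codifferential i f) = 0.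
Proof.
apply: linear_ext => x /=.
by case: (free_cover _ x) => y /= /eqP hy; rewrite hy !raddf0.
Qed.

(* The i-th cohomology of Hom(F_0, N) -> Hom(F_1, N) -> ..., where F is the
   free resolution of M above *)
Definition Ext (i : nat) : lmodType R :=
  if i is j.+1 then cohomology (@codifferentialK j)
  else kernel (codifferential 0).

End FreeResolution.

Definition dual (R : comNzRingType) (M : lmodType R) : lmodType R :=
  {linear M -> R^o}.

Section Biduality.
Variables (R : comNzRingType) (M : lmodType R).

Definition evaluation (x : M) (phi : dual M) : R^o := phi x.

Fact evaluation_is_linear x : linear (evaluation x).
Proof. by []. Qed.
HB.instance Definition _ x :=
  GRing.isLinear.Build R (dual M) R^o _ (evaluation x)
    (evaluation_is_linear x).

Definition biduality (x : M) : dual (dual M) := evaluation x.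

Fact biduality_is_linear : linear biduality.
Proof. by move=> a x y; apply: linear_ext => phi; exact: linearP. Qed.
HB.instance Definition _ :=
  GRing.isLinear.Build R M (dual (dual M)) _ biduality biduality_is_linear.

End Biduality.

Definition gorenstein_projective (R : comNzRingType) (M : lmodType R) : Prop :=
  [/\ finitely_generated M,
      forall i, (1 <= i)%N -> forall c : Ext M R^o i, c = 0,
      forall i, (1 <= i)%N -> forall c : Ext (dual M) R^o i, c = 0
    & bijective (@biduality R M)].

Record category := Category {
  obj :> Type;
  hom : obj -> obj -> Type;
  idm : forall a, hom a a;
  comp : forall a b c, hom b c -> hom a b -> hom a c;
  comp_idl : forall a b (f : hom a b), comp (idm b) f = f;
  comp_idr : forall a b (f : hom a b), comp f (idm a) = f;
  comp_assoc : forall a b c d (h : hom c d) (g : hom b c) (f : hom a b),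
    comp h (comp g f) = comp (comp h g) f
}.

Record functor (C D : category) := Functor {
  fobj :> C -> D;
  fmap : forall a b : C, hom a b -> hom (fobj a) (fobj b);
  fmap_id : forall a : C, fmap (idm a) = idm (fobj a);
  fmap_comp : forall (a b c : C) (g : hom b c) (f : hom a b),
    fmap (comp g f) = comp (fmap g) (fmap f)
}.

Definition fully_faithful (C D : category) (F : functor C D) : Prop :=
  forall a b : C, bijective (@fmap C D F a b).

Section MatrixFactorizations.
Variables (S : comNzRingType) (w : S).

Record mf_obj := MFObj {
  mf1 : lmodType S;
  mf0 : lmodType S;
  rho1 : {linear mf1 -> mf0};
  rho0 : {linear mf0 -> mf1};
  mf1_fg : finitely_generated mf1;
  mf1_proj : projective mf1;
  mf0_fg : finitely_generated mf0;
  mf0_proj : projective mf0;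
  rho10 : forall x, rho1 (rho0 x) = w *: x;
  rho01 : forall x, rho0 (rho1 x) = w *: x
}.

Record mf_hom (X Y : mf_obj) := MFHom {
  mf_hom1 : {linear mf1 X -> mf1 Y};
  mf_hom0 : {linear mf0 X -> mf0 Y};
  mf_hom_rho1 : forall x, rho1 Y (mf_hom1 x) = mf_hom0 (rho1 X x);
  mf_hom_rho0 : forall x, rho0 Y (mf_hom0 x) = mf_hom1 (rho0 X x)
}.

Lemma mf_hom_ext X Y (u v : mf_hom X Y) :
  mf_hom1 u =1 mf_hom1 v -> mf_hom0 u =1 mf_hom0 v -> u = v.
Proof.
case: u v => u1 u0 p q [v1 v0 p' q'] /= /linear_ext e1 /linear_ext e0.
by subst; rewrite (Prop_irrelevance p p') (Prop_irrelevance q q').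
Qed.

Definition mf_id X : mf_hom X X :=
  @MFHom X X idfun idfun (fun=> erefl) (fun=> erefl).

Program Definition mf_comp X Y Z (v : mf_hom Y Z) (u : mf_hom X Y) :
    mf_hom X Z :=
  @MFHom X Z (mf_hom1 v \o mf_hom1 u) (mf_hom0 v \o mf_hom0 u) _ _.
Next Obligation. by rewrite !mf_hom_rho1. Qed.
Next Obligation. by rewrite !mf_hom_rho0. Qed.

Program Definition MF : category := @Category mf_obj mf_hom mf_id mf_comp _ _ _.
Next Obligation. by apply: mf_hom_ext. Qed.
Next Obligation. by apply: mf_hom_ext. Qed.
Next Obligation. by apply: mf_hom_ext. Qed.

End MatrixFactorizations.

Section Monomorphisms.
Variables (S : comNzRingType) (w : S).

Record mon_obj := MonObj {
  mon1 : lmodType S;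
  mon0 : lmodType S;
  mon_map : {linear mon1 -> mon0};
  mon1_gproj : gorenstein_projective mon1;
  mon0_gproj : gorenstein_projective mon0;
  mon_inj : injective mon_map;
  mon_coker : forall c : coker mon_map, w *: c = 0
}.

Record mon_hom (X Y : mon_obj) := MonHom {
  mon_hom1 : {linear mon1 X -> mon1 Y};
  mon_hom0 : {linear mon0 X -> mon0 Y};
  mon_hom_map : forall x, mon_map Y (mon_hom1 x) = mon_hom0 (mon_map X x)
}.

Lemma mon_hom_ext X Y (u v : mon_hom X Y) :
  mon_hom1 u =1 mon_hom1 v -> mon_hom0 u =1 mon_hom0 v -> u = v.
Proof.
case: u v => u1 u0 p [v1 v0 p'] /= /linear_ext e1 /linear_ext e0.
by subst; rewrite (Prop_irrelevance p p').
Qed.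

Definition mon_id X : mon_hom X X := @MonHom X X idfun idfun (fun=> erefl).

Program Definition mon_comp X Y Z (v : mon_hom Y Z) (u : mon_hom X Y) :
    mon_hom X Z :=
  @MonHom X Z (mon_hom1 v \o mon_hom1 u) (mon_hom0 v \o mon_hom0 u) _.
Next Obligation. by rewrite !mon_hom_map. Qed.

Program Definition Mon : category :=
  @Category mon_obj mon_hom mon_id mon_comp _ _ _.
Next Obligation. by apply: mon_hom_ext. Qed.
Next Obligation. by apply: mon_hom_ext. Qed.
Next Obligation. by apply: mon_hom_ext. Qed.

End Monomorphisms.

(* Main.v *)
Require Import Defs.
From mathcomp Require Import all_boot all_algebra.
From HB Require Import structures.
From mathcomp Require Import boolp.
From mathcomp.multinomials Require Import freeg.

(** The functor sends a factorization (rho1, rho0) to rho1 and is the identity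
    on pairs of maps.  A finitely generated projective module P has a finite
    dual basis, which makes its dual projective and biduality bijective; Ext
    vanishes because every syzygy of the free resolution of P is a retract of a
    free module.  The dual basis also shows that w is regular on P, so rho1 is
    injective as rho0 rho1 = w, and rho1 rho0 = w kills the cokernel of rho1.
    Fullness: if q1 psi1 = psi0 rho1, then
    q1 q0 psi0 = w psi0 = psi0 rho1 rho0 = q1 psi1 rho0, and q1 is injective. *)

Set Implicit Arguments.
Unset Strict Implicit.
Unset Printing Implicit Defensive.

Import GRing.Theory.
Local Open Scope ring_scope.
Local Open Scope quotient_scope.

(** * Linear maps given by finite families *)

Section LinearCombination.
Variables (R : comNzRingType) (P A : lmodType R) (n : nat).
Variables (phi : 'I_n -> dual P) (a : 'I_n -> A).

(** The target [A] is arbitrary because the formula serves twice: with [A = P] for the dual basis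
    identity, and for lifting maps out of [P]. *)
Definition lincomb (x : P) : A := \sum_i (phi i x : R) *: a i.

Fact lincomb_is_linear : linear lincomb.
Proof.
move=> c x y; rewrite /lincomb scaler_sumr -big_split /=.
by apply: eq_bigr => i _; rewrite linearP scalerDl scalerA.
Qed.
HB.instance Definition _ :=
  GRing.isLinear.Build R P A _ lincomb lincomb_is_linear.

End LinearCombination.

Section RowCombination.
Variables (R : comNzRingType) (M : lmodType R) (n : nat) (e : 'I_n -> M).

Definition row_comb (v : 'rV[R]_n) : M := \sum_i v 0 i *: e i.

Fact row_comb_is_linear : linear row_comb.
Proof.
move=> c u v; rewrite /row_comb scaler_sumr -big_split /=.
by apply: eq_bigr => i _; rewrite !mxE scalerDl scalerA.
Qed.
HB.instance Definition _ :=
  GRing.isLinear.Build R 'rV[R]_n M _ row_comb row_comb_is_linear.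

End RowCombination.

Section Coordinate.
Variables (R : comNzRingType) (n : nat) (i : 'I_n).

Definition row_coord (v : 'rV[R]_n) : R^o := v 0 i.

Fact row_coord_is_linear : linear row_coord.
Proof. by move=> c u v; rewrite /row_coord !mxE. Qed.
HB.instance Definition _ :=
  GRing.isLinear.Build R 'rV[R]_n R^o _ row_coord row_coord_is_linear.

End Coordinate.

(** * Finite dual bases *)

Section DualBasis.
Variable R : comNzRingType.
Implicit Type P : lmodType R.

Definition dual_basis P n (phi : 'I_n -> dual P) (e : 'I_n -> P) : Prop :=
  forall x, x = lincomb phi e x.

(** Generators give a surjection from a finite free module, which splits; the coordinates of the
    splitting are the functionals. *)
Lemma projective_dual_basis P : finitely_generated P -> projective P ->
  exists n (phi : 'I_n -> dual P) (e : 'I_n -> P), dual_basis phi e.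
Proof.
move=> [n [e genP]] projP.
have [s sK] : exists s : {linear P -> 'rV[R]_n}, forall x, row_comb e (s x) = x.
  apply: (projP _ _ (row_comb e) idfun) => x.
  have [c ->] := genP x; exists (\row_i c i).
  by apply: eq_bigr => i _; rewrite mxE.
pose phi i : dual P := @row_coord R n i \o s : {linear P -> R^o}.
by exists n, phi, e => x; rewrite -[LHS]sK.
Qed.

Variables (P : lmodType R) (n : nat) (phi : 'I_n -> dual P) (e : 'I_n -> P).
Hypothesis phi_e : dual_basis phi e.

Lemma dual_basis_projective : projective P.
Proof.
move=> A B g f surj_g.
have [a ga] := choice (fun i => surj_g (f (e i))).
exists (lincomb phi a) => x; rewrite [in RHS](phi_e x) /= /lincomb !linear_sum.
by apply: eq_bigr => i _; rewrite !linearZ /= ga.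
Qed.

Lemma dual_basis_sep x : (forall i, phi i x = 0) -> x = 0.
Proof.
move=> phi0; rewrite (phi_e x) /lincomb big1 // => i _.
by rewrite phi0 scale0r.
Qed.

(** Applying [psi] to the expansion of [x] gives [psi x] as the sum of the [phi i x * psi (e i)]. *)
Lemma dual_basis_dual : dual_basis (fun i => biduality (e i)) phi.
Proof.
move=> psi; apply: linear_ext => x.
rewrite [in LHS](phi_e x) /lincomb linear_sum.
have sumE (I : Type) (r : seq I) (F : I -> dual P) :
    (\sum_(i <- r) F i : dual P) x = \sum_(i <- r) F i x.
  by elim/big_rec2: _ => //= i y f _ <-.
rewrite sumE; apply: eq_bigr => i _.
by rewrite linearZ /= /GRing.scale /= mulrC.
Qed.

Lemma dual_basis_biduality : bijective (@biduality R P).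
Proof.
(* If [Psi] is evaluation at [x], this is the expansion of [x]. *)
pose inv (Psi : dual (dual P)) : P := \sum_i (Psi (phi i) : R) *: e i.
exists inv => [x | Psi]; first by rewrite {2}(phi_e x).
apply: linear_ext => psi; rewrite [in RHS](dual_basis_dual psi).
rewrite /= /evaluation /inv /lincomb !linear_sum; apply: eq_bigr => i _.
by rewrite !linearZ /= /GRing.scale /= mulrC.
Qed.

End DualBasis.

(** * Free modules on a set *)

Section FreeModule.
Variables (R : comNzRingType) (K : choiceType).

Lemma free_linear_ext (M : lmodType R) (f g : {linear {freeg K / R} -> M}) :
  (forall x, f << x >> = g << x >>) -> f =1 g.
Proof.
move=> fg D; rewrite -(freeg_sumE D) !linear_sum; apply: eq_bigr => x _.
have -> : << coeff x D *g x >> = coeff x D *: << x >> :> {freeg K / R}.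
  by apply/eqP/freeg_eqP => y; rewrite coeffZ !coeffU mul1r.
by rewrite !linearZ /= fg.
Qed.

Lemma free_projective : projective {freeg K / R}.
Proof.
move=> A B g f surj_g.
have [a ga] := choice (fun x => surj_g (f << x >>)).
exists (fglift a) => D; apply: (free_linear_ext (f := g \o fglift a)) => x /=.
by rewrite liftU scale1r.
Qed.

End FreeModule.

(** * Vanishing of Ext on projective modules *)

Section Vanishing.
Variable R : comNzRingType.

Lemma free_coverU (M : lmodType R) (x : M) : free_cover M << x >> = x.
Proof. by rewrite /= liftU scale1r. Qed.

Lemma projective_section (M : lmodType R) : projective M ->
  exists s : {linear M -> {freeg M / R}}, forall x, free_cover M (s x) = x.
Proof.
move=> projM; apply: (projM _ _ (free_cover M) idfun) => x.
by exists << x >>; exact: free_coverU.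
Qed.

(** The map [id - s f] lands in the kernel of [f] and fixes it pointwise. *)
Lemma kernel_retraction (V W : lmodType R) (f : {linear V -> W})
    (s : {linear W -> V}) : (forall y, f (s y) = y) ->
  exists r : {linear V -> kernel f}, forall k, r (val k) = k.
Proof.
move=> sK.
have r0 x : f ((idfun \- (s \o f) : {linear V -> V}) x) = 0.
  by rewrite /= linearB /= sK subrr.
exists (corestrict r0) => k; apply: val_inj => /=.
by case: k => k /= /eqP ->; rewrite linear0 subr0.
Qed.

Lemma syzygy_projective (M : lmodType R) i :
  projective M -> projective (syzygy M i).
Proof.
move=> projM; elim: i => //= i /projective_section[s sK] A B g f surj_g.
have [r rK] := kernel_retraction sK.
(* The syzygy is a retract of a free module: extend [f] along [r], lift there, then restrict. *)
have [h gh] := free_projective (f \o r) surj_g.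
exists (h \o (val : kernel _ -> _)) => x.
by rewrite /= gh /= rK.
Qed.

(* A cocycle f on F_{j+1} kills the kernel of F_{j+1} -> K_{j+1}; with a section
   s of that map and a retraction r of K_{j+1} -> F_j, f is the coboundary of
   f s r. *)
Lemma projective_Ext_eq0 (M N : lmodType R) i :
  projective M -> (1 <= i)%N -> forall c : Ext M N i, c = 0.
Proof.
move=> projM; case: i => // j _ c.
have [s sK] := projective_section (@syzygy_projective M j.+1 projM).
have [t tK] := projective_section (@syzygy_projective M j projM).
have [r rK] := kernel_retraction tK.
rewrite -[c]reprK; case: (repr c) => f f_ker.
have f_val k : f (val (k : syzygy M j.+2)) = 0.
  (* The cocycle condition is read off at the basis element [<< k >>], which covers [k]. *)
  have /eqP/(congr1 (fun g : {linear _ -> _} => g << k >>)) /= := f_ker.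
  by rewrite free_coverU.
have fE D : f (s (free_cover _ D)) = f D.
  have kerD : s (free_cover _ D) - D \in in_kernel (free_cover (syzygy M j.+1)).
    by rewrite unfold_in linearB sK subrr.
  apply/eqP; rewrite -subr_eq0 -linearB; apply/eqP.
  exact: (f_val (Kernel kerD)).
apply/eqP; rewrite -[0]pi_zeror -Quotient.idealrBE subr0.
apply/asboolP; exists (f \o (s \o r) : {linear resolution M j -> N}).
apply: val_inj; apply: linear_ext => D /=.
by rewrite rK fE.
Qed.

End Vanishing.

(** * Gorenstein projectivity and regularity *)

Lemma fg_projective_gorenstein (R : comNzRingType) (P : lmodType R) :
  finitely_generated P -> projective P -> gorenstein_projective P.
Proof.
move=> fgP projP.
have [n [phi [e phi_e]]] := projective_dual_basis fgP projP.
split=> // [i i_gt0|i i_gt0|]; last exact: dual_basis_biduality phi_e.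
  exact: projective_Ext_eq0.
(* The dual is itself projective, through its own dual basis. *)
apply: projective_Ext_eq0 => //.
exact: dual_basis_projective (dual_basis_dual phi_e).
Qed.

(** Each functional carries the equation into the ring, where [w] cancels, and the functionals
    separate points. *)
Lemma projective_lreg (R : comNzRingType) (P : lmodType R) (w : R) :
    finitely_generated P -> projective P -> GRing.lreg w ->
  injective ( *:%R w : P -> P).
Proof.
move=> fgP projP reg_w x y wxy.
have [n [phi [e phi_e]]] := projective_dual_basis fgP projP.
apply/eqP; rewrite -subr_eq0; apply/eqP.
apply: (dual_basis_sep phi_e) => i; apply: reg_w.
have := congr1 (phi i) wxy; rewrite !linearZ /= /GRing.scale /= => phi_xy.
by rewrite mulr0 linearB /= mulrBr phi_xy subrr.
Qed.

(** * The functor and its full faithfulness *)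

Section Embedding.
Variables (S : comNzRingType) (w : S).
Hypothesis reg_w : GRing.lreg w.

Lemma rho1_inj (X : mf_obj w) : injective (rho1 X).
Proof.
move=> x y exy; apply: (projective_lreg (mf1_fg X) (@mf1_proj _ _ X) reg_w).
by rewrite -!rho01 exy.
Qed.

Lemma rho1_coker (X : mf_obj w) (c : coker (rho1 X)) : w *: c = 0.
Proof.
rewrite -[c]reprK; apply/eqP.
rewrite [X in X == _]pi_coker_scale -[0]pi_zeror -Quotient.idealrBE subr0.
by apply/asboolP; exists (rho0 X (repr c)); rewrite rho10.
Qed.

Definition mf_mon (X : mf_obj w) : mon_obj w :=
  MonObj (fg_projective_gorenstein (mf1_fg X) (@mf1_proj _ _ X))
    (fg_projective_gorenstein (mf0_fg X) (@mf0_proj _ _ X))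
    (@rho1_inj X) (@rho1_coker X).

Definition mf_mon_hom (X Y : mf_obj w) (u : mf_hom X Y) :
    mon_hom (mf_mon X) (mf_mon Y) :=
  @MonHom S w (mf_mon X) (mf_mon Y) (mf_hom1 u) (mf_hom0 u) (mf_hom_rho1 u).

Fact mf_mon_id (X : mf_obj w) : mf_mon_hom (mf_id X) = mon_id (mf_mon X).
Proof. exact: mon_hom_ext. Qed.

Fact mf_mon_comp (X Y Z : mf_obj w) (v : mf_hom Y Z) (u : mf_hom X Y) :
  mf_mon_hom (mf_comp v u) = mon_comp (mf_mon_hom v) (mf_mon_hom u).
Proof. exact: mon_hom_ext. Qed.

Definition mf_mon_functor : functor (MF w) (Mon w) :=
  @Functor (MF w) (Mon w) mf_mon mf_mon_hom mf_mon_id mf_mon_comp.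

(** This is the square that a morphism of monomorphisms does not record; it can be checked after
    applying [rho1 Y]. *)
Lemma mon_hom_rho0 (X Y : mf_obj w) (v : mon_hom (mf_mon X) (mf_mon Y)) x :
  rho0 Y (mon_hom0 v x) = mon_hom1 v (rho0 X x).
Proof.
apply: (@rho1_inj Y); rewrite rho10 (mon_hom_map v) /= rho10.
by rewrite linearZ.
Qed.

Definition mon_mf_hom (X Y : mf_obj w) (v : mon_hom (mf_mon X) (mf_mon Y)) :
    mf_hom X Y :=
  @MFHom S w X Y (mon_hom1 v) (mon_hom0 v) (mon_hom_map v) (mon_hom_rho0 v).

Lemma mf_mon_fully_faithful : fully_faithful mf_mon_functor.
Proof.
move=> X Y; exists (@mon_mf_hom X Y) => u; first exact: mf_hom_ext.
exact: mon_hom_ext.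
Qed.

End Embedding.

Theorem corollary3p6 (S : comNzRingType) (n : {pred S}) (w : S)
  (hnoeth : noetherian S) (hloc : local_ring n)
  (hw : w \in n) (hreg : GRing.lreg w) :
  exists F : functor (MF w) (Mon w), fully_faithful F.
Proof. by exists (mf_mon_functor hreg); exact: mf_mon_fully_faithful. Qed.
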